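(* Let $p\in(0,1)$ and $\beta\ge 0$. Let \[ c_p:=\begin{cases}\dfrac{\log\frac{p}{1-p}}{2p-1}, & p\neq \frac12,\\[1em] 2, & p=\frac12.\end{cases} \] 1. If $\beta\le c_p$, then the constant graphon $W\equiv p$ is the unique maximizer of $\mathcal F_\beta$ over $\mathcal W_p$. 2. If $\beta>c_p$, then the constant graphon $W\equiv p$ is not a maximizer of $\mathcal F_\beta$ over $\mathcal W_p$.
   Context: $\mathcal W$ is the space of symmetric measurable functions $W:[0,1]^2\to[0,1]$ (graphons; functions equal almost everywhere are identified, so uniqueness is up to almost everywhere equality). For $p\in(0,1)$, \[ \mathcal W_p=\Big\{W\in\mathcal W:\int_{[0,1]^2}W(x,y)\,dx\,dy=p\Big\}. \] For $W\in\mathcal W_p$, $\mathcal F_\beta(W):=\beta\,t(W)-I_p(W)$, where \[ t(W)=\int_0^1\Big[\int_0^1W(x,y)\,dy\Big]^2dx,\qquad I_p(W)=\frac12\int_{[0,1]^2}D(W(x,y)\|p)\,dx\,dy, \] \[ D(q\|p)=q\log\frac qp+(1-q)\log\frac{1-q}{1-p},\qquad 0\log 0=0. \] *)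

(* Defs.v *)
From mathcomp Require Import all_boot all_order all_algebra.
From mathcomp Require Import all_classical all_reals all_analysis.

Set Implicit Arguments.
Unset Strict Implicit.
Unset Printing Implicit Defensive.

Import Order.TTheory GRing.Theory Num.Theory.
Import numFieldNormedType.Exports.

Local Open Scope classical_set_scope.
Local Open Scope ring_scope.

Section Graphons.
Context {R : realType}.

(* [measurableTypeR R] is the copy of [R] that carries the Borel sigma-algebra
   on which [lebesgue_measure] is declared; using it throughout keeps the
   product structure on the plane identical to that of the product measure. *)
Local Notation plane := (measurableTypeR R * measurableTypeR R)%type.
Implicit Types (W : plane -> R) (p q beta : R).

Local Notation mu := (@lebesgue_measure R).
Local Notation mu2 := (mu \x mu)%E.

Definition unit_square : set plane := `[0%R, 1%R] `*` `[0%R, 1%R].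

(* Only the values on the unit square matter. Symmetry and the bounds are
   required pointwise and measurability is Borel; modulo equality almost
   everywhere, this gives the same classes as Lebesgue measurability with the
   conditions imposed almost everywhere. *)
Definition graphon W : Prop :=
  [/\ measurable_fun unit_square W,
      forall x y : measurableTypeR R, unit_square (x, y) -> W (x, y) = W (y, x)
    & forall z, unit_square z -> 0 <= W z <= 1].

Definition graphon_density p W : Prop :=
  graphon W /\ \int[mu2]_(z in unit_square) W z = p.

(* The convention 0 log 0 = 0 holds since [ln 0] is a real number. *)
Definition rel_entropy q p : R :=
  q * ln (q / p) + (1 - q) * ln ((1 - q) / (1 - p)).

Definition two_star W : R :=
  \int[mu]_(x in `[0, 1]) (\int[mu]_(y in `[0, 1]) W (x, y)) ^+ 2.

Definition rate p W : R :=
  2^-1 * \int[mu2]_(z in unit_square) rel_entropy (W z) p.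

Definition free_energy beta p W : R := beta * two_star W - rate p W.

Definition maximizer beta p W : Prop :=
  graphon_density p W /\
  forall W', graphon_density p W' ->
    free_energy beta p W' <= free_energy beta p W.

Definition unique_maximizer beta p W : Prop :=
  maximizer beta p W /\
  forall W', maximizer beta p W' -> ae_eq mu2 unit_square W' W.

Definition critical_beta p : R :=
  if p == 2^-1 then 2 else ln (p / (1 - p)) / (2 * p - 1).

End Graphons.

(* Main.v *)
(* With [g = W - p], [f x = \int g (x, y) dy] and [D = rel_entropy _ p], the
   constant graphon loses to [W] exactly when [beta * \int f^2] exceeds
   [2^-1 * \int D (W)]. Symmetry of [g] gives [2 * \int f^2 <= \int g^2], and
   [critical_beta p] is the best constant [c] in [c * (q - p)^2 <= D q], with
   equality only at [q = p] and [q = 1 - p]: up to affine terms [D] is a function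
   of [(2 q - 1)^2] that is strictly convex, since [ln ((1 + s) / (1 - s)) / s]
   is increasing. A maximizer for [beta <= critical_beta p] then takes only the
   values [p] and [1 - p], and having mean [p] it is constant. Above the critical
   value, some [b] has [D (p + b) < beta * b^2], and changing the value to
   [p + b] on a thin cross improves on the constant. *)
Require Import Defs.
From mathcomp Require Import all_boot all_order all_algebra.
From mathcomp Require Import all_classical all_reals all_analysis.
From mathcomp Require Import measurable_realfun ring lra.
Import Order.TTheory GRing.Theory Num.Theory.
Import numFieldNormedType.Exports.
Local Open Scope classical_set_scope.
Local Open Scope ring_scope.

Set Implicit Arguments.
Unset Strict Implicit.
Unset Printing Implicit Defensive.

(** * Bounded measurable functions and vanishing integrals *)

Definition bounded_measurable {R : realType} {d : measure_display}
    {T : measurableType d} (D : set T) (f : T -> R) : Prop :=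
  measurable_fun D f /\ exists M, forall x, D x -> `|f x| <= M.

Section BoundedMeasurable.
Context {R : realType} {d : measure_display} {T : measurableType d}.
Variable D : set T.
Implicit Types f g : T -> R.

Lemma bounded_measurable_cst c : bounded_measurable D (fun=> c : R).
Proof. by split=> //; exists `|c|. Qed.

Lemma bounded_measurableD f g : bounded_measurable D f ->
  bounded_measurable D g -> bounded_measurable D (fun x => f x + g x).
Proof.
move=> [mf [M fM]] [mg [N gN]]; split; first exact: measurable_funD.
by exists (M + N) => x Dx; rewrite (le_trans (ler_normD _ _))// lerD// ?fM ?gN.
Qed.

Lemma bounded_measurableM f g : bounded_measurable D f ->
  bounded_measurable D g -> bounded_measurable D (fun x => f x * g x).
Proof.
move=> [mf [M fM]] [mg [N gN]]; split; first exact: measurable_funM.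
by exists (M * N) => x Dx; rewrite normrM ler_pM// ?fM ?gN.
Qed.

Lemma bounded_measurableZ c f : bounded_measurable D f ->
  bounded_measurable D (fun x => c * f x).
Proof. by apply: bounded_measurableM; exact: bounded_measurable_cst. Qed.

Lemma bounded_measurableB f g : bounded_measurable D f ->
  bounded_measurable D g -> bounded_measurable D (fun x => f x - g x).
Proof.
move=> bf [mg [N gN]]; apply: bounded_measurableD => //.
split; first exact: measurableT_comp.
by exists N => x Dx; rewrite normrN gN.
Qed.

Lemma bounded_measurable_sqr f : bounded_measurable D f ->
  bounded_measurable D (fun x => f x ^+ 2).
Proof. by move=> bf; under eq_fun do rewrite expr2; exact: bounded_measurableM. Qed.

(** Integrability is not preserved by products, so integrands are assembled as bounded measurable
    functions and integrability is derived only at the end. *)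
Lemma bounded_measurable_integrable (m : {measure set T -> \bar R}) f :
  measurable D -> (m D < +oo)%E -> bounded_measurable D f ->
  m.-integrable D (EFin \o f).
Proof.
move=> mD mfin [mf [M fM]]; apply: measurable_bounded_integrable => //.
exists M; split; first exact: num_real.
by move=> N MN x Dx /=; rewrite (le_trans (fM _ Dx))// ltW.
Qed.

End BoundedMeasurable.

Lemma Rintegral_eq0_ae_eq0 {R : realType} {d : measure_display}
    {T : measurableType d} (m : {measure set T -> \bar R}) (D : set T)
    (f : T -> R) : measurable D -> m.-integrable D (EFin \o f) ->
  (forall x, D x -> 0 <= f x) -> \int[m]_(x in D) f x = 0 ->
  ae_eq m D f (fun=> 0).
Proof.
move=> mD intf f_ge0 f0.
have : ae_eq m D (EFin \o f) (cst 0%E).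
  have /integrableP[mf _] := intf.
  apply/(ae_eq_integral_abs m mD mf).
  rewrite -(fineK (integrable_fin_num mD (integrable_abse intf))); congr _%:E.
  rewrite -[RHS]f0; congr fine; apply: eq_integral => x /set_mem Dx.
  by rewrite /= ger0_norm// f_ge0.
by apply: filterS => x /= + Dx => /(_ Dx) [].
Qed.

(** * Integration over the unit square *)

Section UnitSquare.
Context {R : realType}.
Local Notation plane := (measurableTypeR R * measurableTypeR R)%type.
Local Notation mu := (@lebesgue_measure R).
Local Notation mu2 := (mu \x mu)%E.
Local Notation I01 := (`[0%R, 1%R]%classic : set (measurableTypeR R)).
Local Notation square := (@unit_square R).

Lemma measure_unit_interval : mu I01 = 1%E.
Proof. by rewrite lebesgue_measure_itv /= lte_fin ltr01 oppr0 adde0. Qed.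

Lemma measurable_unit_interval : measurable I01.
Proof. exact: measurable_itv. Qed.

Lemma measurable_unit_square : measurable square.
Proof. by apply: measurableX; exact: measurable_itv. Qed.

Lemma measure_unit_square : mu2 square = 1%E.
Proof.
transitivity (mu I01 * mu I01)%E; first exact: product_measure1E.
by rewrite measure_unit_interval mule1.
Qed.

Lemma Rintegral_unit_interval_cst (c : R) : \int[mu]_(x in I01) c = c.
Proof.
rewrite Rintegral_cst; last exact: measurable_unit_interval.
rewrite -[RHS]mulr1; congr (_ * _).
exact: (congr1 fine measure_unit_interval).
Qed.

Lemma Rintegral_unit_square_cst (c : R) : \int[mu2]_(z in square) c = c.
Proof.
rewrite Rintegral_cst; last exact: measurable_unit_square.
rewrite -[RHS]mulr1; congr (_ * _).
exact: (congr1 fine measure_unit_square).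
Qed.

Lemma integrable_unit_interval (f : measurableTypeR R -> R) : bounded_measurable I01 f ->
  mu.-integrable I01 (EFin \o f).
Proof.
apply: bounded_measurable_integrable; first exact: measurable_itv.
suff : (mu I01 < +oo)%E by [].
by rewrite measure_unit_interval ltry.
Qed.

Lemma integrable_unit_square (f : plane -> R) : bounded_measurable square f ->
  mu2.-integrable square (EFin \o f).
Proof.
apply: bounded_measurable_integrable; first exact: measurable_unit_square.
suff : (mu2 square < +oo)%E by [].
by rewrite measure_unit_square ltry.
Qed.

Lemma bounded_measurable_fst (f : measurableTypeR R -> R) : bounded_measurable I01 f ->
  bounded_measurable square (fun z : plane => f z.1).
Proof.
move=> [mf [M fM]]; split; last by exists M => -[x y] [/= Ix _]; exact: fM.
apply: (measurable_comp _ _ mf); first exact: measurable_itv.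
  by move=> _ [[x y] [Ix Iy] <-].
exact: measurable_funTS measurable_fst.
Qed.

Lemma bounded_measurable_snd (f : measurableTypeR R -> R) : bounded_measurable I01 f ->
  bounded_measurable square (fun z : plane => f z.2).
Proof.
move=> [mf [M fM]]; split; last by exists M => -[x y] [_ /=]; exact: fM.
apply: (measurable_comp _ _ mf); first exact: measurable_itv.
  by move=> _ [[x y] [Ix Iy] <-].
exact: measurable_funTS measurable_snd.
Qed.

Lemma bounded_measurable_section (f : plane -> R) x : I01 x ->
  bounded_measurable square f -> bounded_measurable I01 (fun y => f (x, y)).
Proof.
move=> Ix [mf [M fM]]; split; last by exists M => y Iy; exact: fM.
apply: (measurable_comp _ _ mf); first exact: measurable_unit_square.
  by move=> _ [y Iy <-].
exact: measurable_funTS (pair1_measurable x).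
Qed.

Lemma restrict_unit_square (f : plane -> R) x y :
  (f \_ square) (x, y) =
  if x \in I01 then ((fun y => f (x, y)) \_ I01) y else 0.
Proof.
rewrite /= !patchE /unit_square.
by rewrite in_setX/=; case: (x \in I01).
Qed.

(** Fubini's theorem is applied on the whole plane with extended real values. Extension by zero
    transfers it to the square, and the inner integrals are finite because sections over the
    interval are bounded. *)
Lemma fubini_F_restrict (f : plane -> R) : bounded_measurable square f ->
  fubini_F mu (EFin \o (f \_ square)) =
  EFin \o ((fun x => \int[mu]_(y in I01) f (x, y)) \_ I01).
Proof.
move=> bf; apply/funext => x; rewrite /fubini_F/= [in RHS]patchE.
under eq_integral do rewrite restrict_unit_square.
case: ifPn => [/set_mem Ix|_]; last by rewrite integral0.
rewrite /= fineK.
  by rewrite integral_mkcond; under [RHS]eq_integral do rewrite restrict_EFin.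
apply: integrable_fin_num; first exact: measurable_itv.
exact/integrable_unit_interval/bounded_measurable_section.
Qed.

Lemma integrable_restrict_unit_square (f : plane -> R) :
  bounded_measurable square f ->
  mu2.-integrable setT (EFin \o (f \_ square)).
Proof.
move=> /integrable_unit_square.
rewrite integrable_mkcond; last exact: measurable_unit_square.
by rewrite restrict_EFin.
Qed.

Lemma bounded_measurable_marginal (f : plane -> R) :
  bounded_measurable square f ->
  bounded_measurable I01 (fun x => \int[mu]_(y in I01) f (x, y)).
Proof.
move=> bf; split.
  have := measurable_fubini_F (integrable_restrict_unit_square bf).
  rewrite fubini_F_restrict// => /measurable_EFinP.
  by move/(measurable_restrictT _ measurable_unit_interval).
have [_ [M fM]] := bf; exists M => x Ix.
have bfx := bounded_measurable_section Ix bf.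
apply: (le_trans (le_normr_Rintegral measurable_unit_interval
  (integrable_unit_interval bfx))).
rewrite -[leRHS]Rintegral_unit_interval_cst.
apply: le_Rintegral; first exact: measurable_unit_interval.
- apply: integrable_unit_interval; split; last first.
    by exists M => y Iy; rewrite normr_id; exact: fM.
  by apply: measurableT_comp => //; case: bfx.
- exact/integrable_unit_interval/bounded_measurable_cst.
- by move=> y Iy; exact: fM.
Qed.

Lemma Rintegral_unit_square (f : plane -> R) : bounded_measurable square f ->
  \int[mu2]_(z in square) f z =
  \int[mu]_(x in I01) \int[mu]_(y in I01) f (x, y).
Proof.
move=> bf; rewrite Rintegral_mkcond [RHS]Rintegral_mkcond; congr fine.
rewrite -(integral12_prod_meas1 (integrable_restrict_unit_square bf)).
by rewrite fubini_F_restrict.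
Qed.

(** Integrating the left side with the first coordinate outside and the right side with the second
    outside yields the same iterated integral. *)
Lemma Rintegral_unit_square_swap (f : plane -> R) :
  bounded_measurable square f ->
  \int[mu2]_(z in square) f (z.2, z.1) = \int[mu2]_(z in square) f z.
Proof.
move=> bf; rewrite Rintegral_mkcond [RHS]Rintegral_mkcond; congr fine.
have bg : bounded_measurable square (fun z : plane => f (z.2, z.1)).
  have [mf [M fM]] := bf; split; last by exists M => -[x y] [Ix Iy]; exact: fM.
  apply: (measurable_comp _ _ mf); first exact: measurable_unit_square.
    by move=> _ [[x y] [Ix Iy] <-].
  by apply/measurable_funTS/measurable_fun_pair;
    [exact: measurable_snd|exact: measurable_fst].
rewrite -(integral12_prod_meas1 (integrable_restrict_unit_square bg)).
rewrite -(integral21_prod_meas1 (integrable_restrict_unit_square bf)).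
apply: eq_integral => x _; apply: eq_integral => y _ /=; congr _%:E.
by rewrite !patchE /unit_square !in_setX/= andbC.
Qed.

End UnitSquare.

(** * The sharp quadratic lower bound for the relative entropy *)

Section RelativeEntropy.
Context {R : realType}.
Implicit Types p q r s c : R.

(** Derivatives are required only in the open interval, so that [sym_entropy] can be treated up to
    the endpoint 1, where [log_odds] blows up. *)
Lemma is_derive_lt_cc (f df : R -> R) (a b : R) :
  (forall x, a < x < b -> is_derive x 1 f (df x)) ->
  (forall x, a < x < b -> 0 < df x) ->
  {within `[a, b], continuous f} ->
  forall x y, a <= x -> x < y -> y <= b -> f x < f y.
Proof.
move=> fdf df0 cf x y ax xy yb; apply: (@gtr0_derive1_lt_cc _ f a b) => //.
- by move=> z /[!in_itv]/= /fdf [].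
- by move=> z /[!in_itv]/= /[dup] /fdf [_ fz] /df0; rewrite derive1E fz.
- by rewrite in_itv/= ax (le_trans (ltW xy)).
- by rewrite in_itv/= yb (le_trans ax (ltW xy)).
Qed.

(** With [y = Num.sqrt x] positive, [x * ln x = 2 * y * (y * ln y)], and [ln y^-1 < y^-1] bounds
    [y * ln y] by 1 in absolute value. This gives continuity of [x * ln x] at 0. *)
Lemma norm_xlnx_le x : x <= 1 -> `|x * ln x : R| <= 2 * Num.sqrt x.
Proof.
have [x0 _|x0 x1] := leP x 0.
  by rewrite ln0// mulr0 normr0 mulr_ge0// sqrtr_ge0.
have y0 : 0 < Num.sqrt x by rewrite sqrtr_gt0.
rewrite ler0_norm; last by rewrite mulr_ge0_le0 ?(ltW x0)// ln_le0.
have := ln_sublinear (_ : 0 < (Num.sqrt x)^-1); rewrite invr_gt0 => /(_ y0).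
rewrite lnV ?posrE// => /ltW; rewrite -(ler_pM2l y0) mulfV ?gt_eqF// => h.
rewrite -{1 2}(sqr_sqrtr (ltW x0)) lnXn// mulr2n.
by nra.
Qed.

Lemma continuous_xlnx : continuous (fun x : R => x * ln x).
Proof.
move=> x; have [x0|x0|->] := ltgtP x 0.
- rewrite /continuous_at ln0 ?(ltW x0)// mulr0.
  apply: cvg_near_cst; near=> y; rewrite ln0 ?mulr0//.
  by near: y; exact: lt_le_nbhsl.
- by apply: continuousM; [exact: cvg_id|exact: continuous_ln].
- rewrite /continuous_at mul0r; apply: norm_cvg0.
  apply: (@squeeze_cvgr _ _ _ _ (cst 0) (fun y => 2 * Num.sqrt y)).
  + near=> y; rewrite normr_ge0/= norm_xlnx_le//.
    by near: y; apply: lt_le_nbhsl.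
  + exact: cvg_cst.
  + rewrite -[X in _ --> X](mulr0 2); apply: cvgM; first exact: cvg_cst.
    by rewrite -[X in _ --> X](sqrtr0 R); exact: sqrt_continuous.
Unshelve. all: by end_near. Qed.

(* [log_odds s] and [sym_entropy s] are the log-odds and twice the negative
   entropy, up to a constant, of the Bernoulli parameter [(1 + s) / 2]. *)
Definition log_odds s : R := ln (1 + s) - ln (1 - s).

Definition sym_entropy s : R := (1 + s) * ln (1 + s) + (1 - s) * ln (1 - s).

Lemma log_oddsN s : log_odds (- s) = - log_odds s.
Proof. by rewrite /log_odds opprK opprB. Qed.

Lemma sym_entropyN s : sym_entropy (- s) = sym_entropy s.
Proof. by rewrite /sym_entropy opprK addrC. Qed.

Lemma continuous_sym_entropy : continuous sym_entropy.
Proof.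
move=> s; rewrite /continuous_at /sym_entropy; apply: cvgD.
  apply: (@continuous_comp _ _ _ (fun s : R => 1 + s) (fun x => x * ln x)).
    by apply: cvgD; [exact: cvg_cst|exact: cvg_id].
  exact: continuous_xlnx.
apply: (@continuous_comp _ _ _ (fun s : R => 1 - s) (fun x => x * ln x)).
  by apply: cvgB; [exact: cvg_cst|exact: cvg_id].
exact: continuous_xlnx.
Qed.

Lemma is_derive_ln1D s : -1 < s -> is_derive s 1 (fun x => ln (1 + x)) (1 + s)^-1.
Proof.
move=> s1; have s0 : 0 < 1 + s by lra.
have := @is_derive1_comp _ _ (fun x : R => 1 + x) s _ _ (is_derive1_ln s0) _.
by move=> /(_ _ (is_deriveD _ _)) h; apply: is_derive_eq; rewrite add0r mulr1.
Qed.

Lemma is_derive_ln1B s : s < 1 -> is_derive s 1 (fun x => ln (1 - x)) (- (1 - s)^-1).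
Proof.
move=> s1; have s0 : 0 < 1 - s by lra.
have := @is_derive1_comp _ _ (fun x : R => 1 - x) s _ _ (is_derive1_ln s0) _.
by move=> /(_ _ (is_deriveB _ _)) h; apply: is_derive_eq; rewrite sub0r mulrN1.
Qed.

Lemma is_derive_log_odds s : -1 < s < 1 ->
  is_derive s 1 log_odds (2 / (1 - s ^+ 2)).
Proof.
move=> /andP[s1 s1']; have d1 := is_derive_ln1D s1.
have d2 := is_derive_ln1B s1'.
have d3 := is_deriveB d1 d2; apply: is_derive_eq.
have ? : 1 + s != 0 by rewrite gt_eqF; lra.
have ? : 1 - s != 0 by rewrite gt_eqF; lra.
have ? : 1 - s ^+ 2 != 0 by rewrite gt_eqF; nra.
by field; apply/and3P; split.
Qed.

Lemma is_derive_sym_entropy s : -1 < s < 1 ->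
  is_derive s 1 sym_entropy (log_odds s).
Proof.
move=> /andP[s1 s1']; have d1 := is_derive_ln1D s1.
have d2 := is_derive_ln1B s1'.
have d3 : is_derive s 1 (fun x : R => 1 + x) 1.
  by apply: is_derive_eq; ring.
have d4 : is_derive s 1 (fun x : R => 1 - x) (-1).
  by apply: is_derive_eq; ring.
have d5 := is_deriveD (is_deriveM d3 d1) (is_deriveM d4 d2).
apply: is_derive_eq; rewrite /log_odds /GRing.scale/=.
have ? : 1 + s != 0 by rewrite gt_eqF; lra.
have ? : 1 - s != 0 by rewrite gt_eqF; lra.
by field; apply/andP; split.
Qed.

Lemma derivable_continuous_within (f df : R -> R) (a b : R) :
  (forall x, a <= x <= b -> is_derive x 1 f (df x)) ->
  {within `[a, b], continuous f}.
Proof.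
move=> fdf; apply: derivable_within_continuous => x /[!in_itv]/= /fdf.
by case.
Qed.

(** The difference vanishes at 0 and has derivative [4 * x ^+ 2 / (1 - x ^+ 2) ^+ 2]. The inequality
    is the positivity of the derivative of [log_odds s / s]. *)
Lemma log_odds_lt s : 0 < s < 1 -> log_odds s < 2 * s / (1 - s ^+ 2).
Proof.
move=> /andP[s0 s1].
pose f (x : R) := 2 * x / (1 - x ^+ 2) - log_odds x.
pose df (x : R) := 4 * x ^+ 2 / (1 - x ^+ 2) ^+ 2.
have fdf (x : R) : -1 < x < 1 -> is_derive x 1 f (df x).
  move=> x1; have d1 := is_derive_log_odds x1.
  have x2 : 1 - x ^+ 2 != 0 by move: x1 => /andP[? ?]; rewrite gt_eqF; nra.
  have d2 : is_derive x 1 (fun x : R => 1 - x ^+ 2) (- (2 * x)).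
    by apply: is_derive_eq; rewrite /GRing.scale/=; ring.
  have d3 := is_deriveB (is_deriveM (is_deriveZ 2 (is_derive_id x 1))
    (@is_deriveV _ (fun y : R => 1 - y ^+ 2) x _ _ x2 d2)) d1.
  apply: is_derive_eq; rewrite /GRing.scale/= /GRing.scale/= /df.
  by field.
have : f 0 < f s.
  apply: (@is_derive_lt_cc f df 0 s) => //.
  - by move=> x /andP[? ?]; apply: fdf; lra.
  - move=> x /andP[x0 xs]; rewrite divr_gt0// ?mulr_gt0 ?exprn_gt0//; nra.
  - by apply: (@derivable_continuous_within f df) => x /andP[? ?]; apply: fdf; lra.
by rewrite /f /log_odds addr0 subr0 ln1 mulr0 mul0r !subr0 subr_gt0.
Qed.

(** The slope of [log_odds] at 0 is 2, so this is the limiting case [r = 0] of the monotonicity of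
    [log_odds s / s]. *)
Lemma log_odds_gt s : 0 < s < 1 -> 2 * s < log_odds s.
Proof.
move=> /andP[s0 s1].
pose f (x : R) := log_odds x - 2 * x.
pose df (x : R) := 2 / (1 - x ^+ 2) - 2.
have fdf (x : R) : -1 < x < 1 -> is_derive x 1 f (df x).
  move=> x1; have d1 := is_derive_log_odds x1.
  have d3 := is_deriveB d1 (is_deriveZ 2 (is_derive_id x 1)).
  by apply: is_derive_eq; rewrite /GRing.scale/= /GRing.scale/= /df mulr1.
have : f 0 < f s.
  apply: (@is_derive_lt_cc f df 0 s) => //.
  - by move=> x /andP[? ?]; apply: fdf; lra.
  - move=> x /andP[x0 xs]; rewrite /df subr_gt0 ltr_pdivlMr; nra.
  - by apply: (@derivable_continuous_within f df) => x /andP[? ?]; apply: fdf; lra.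
by rewrite /f /log_odds addr0 subr0 ln1 mulr0 !subr0 subr_gt0.
Qed.

(** Since [log_odds s / (2 * s)] is the derivative of [sym_entropy] with respect to [s ^+ 2], this
    is strict convexity in the variable [s ^+ 2]. *)
Lemma log_odds_div_lt r s : 0 < r -> r < s -> s < 1 ->
  log_odds r / r < log_odds s / s.
Proof.
move=> r0 rs s1.
pose f (x : R) := log_odds x / x.
pose df (x : R) := (2 * x / (1 - x ^+ 2) - log_odds x) / x ^+ 2.
have fdf (x : R) : 0 < x < 1 -> is_derive x 1 f (df x).
  move=> /andP[x0 x1].
  have d1 : is_derive x 1 log_odds (2 / (1 - x ^+ 2)).
    by apply: is_derive_log_odds; lra.
  have xn0 : x != 0 by rewrite gt_eqF.
  have x2 : 1 - x ^+ 2 != 0 by rewrite gt_eqF; nra.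
  have d3 := is_deriveM d1 (@is_deriveV _ id x _ _ xn0 (is_derive_id x 1)).
  apply: is_derive_eq; rewrite /GRing.scale/= /GRing.scale/= /df.
  by field; apply/andP.
apply: (@is_derive_lt_cc f df r s) => //.
- by move=> x /andP[? ?]; apply: fdf; lra.
- move=> x /andP[x0 xs]; rewrite /df divr_gt0 ?exprn_gt0//; last by lra.
  by rewrite subr_gt0 log_odds_lt//; lra.
- by apply: (@derivable_continuous_within f df) => x /andP[? ?]; apply: fdf; lra.
Qed.

(** In the variable [s ^+ 2], a strictly convex function lies strictly above its tangent at
    [r ^+ 2], whose slope is [c / 2]. The equation for [c] is void at [r = 0], where the limiting
    value 2 is prescribed instead. *)
Lemma sym_entropy_gt_tangent r s c : 0 <= r < 1 -> 0 <= s <= 1 -> s != r ->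
  c * r = log_odds r -> (r = 0 -> c = 2) ->
  sym_entropy r + c / 2 * (s ^+ 2 - r ^+ 2) < sym_entropy s.
Proof.
move=> /andP[r0 r1] /andP[s0 s1] sr cr c2.
pose h (x : R) := sym_entropy x - c / 2 * x ^+ 2.
pose dh (x : R) := log_odds x - c * x.
have hdh (x : R) : -1 < x < 1 -> is_derive x 1 h (dh x).
  move=> x1; have d1 := is_derive_sym_entropy x1.
  have d2 : is_derive x 1 (fun x : R => c / 2 * x ^+ 2) (c * x).
    by apply: is_derive_eq; rewrite /GRing.scale/= /GRing.scale/=; field.
  exact: is_deriveB d1 d2.
have ch : continuous h.
  move=> x; rewrite /continuous_at /h; apply: cvgB.
    exact: continuous_sym_entropy.
  apply: cvgM; first exact: cvg_cst.
  by apply: (@exprn_continuous R 2).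
have cE : 0 < r -> c = log_odds r / r by move=> ?; rewrite -cr mulfK// gt_eqF.
suff : h r < h s by rewrite /h; lra.
have [sltr|rlts|] := ltgtP s r; last by move/eqP; rewrite (negbTE sr).
- have r_gt0 : 0 < r by lra.
  rewrite -ltrN2.
  apply: (@is_derive_lt_cc (fun x => - h x) (fun x => - dh x) 0 r) => //.
  + by move=> x /andP[? ?]; apply: is_deriveN; apply: hdh; lra.
  + move=> x /andP[x0 xr]; rewrite /dh opprB subr_gt0 -ltr_pdivrMr// cE//.
    exact: log_odds_div_lt.
  + by apply: continuous_subspaceT => x; apply: cvgN; exact: ch.
- apply: (@is_derive_lt_cc h dh r 1) => //.
  + by move=> x /andP[? ?]; apply: hdh; lra.
  + move=> x /andP[rx x1]; rewrite /dh subr_gt0 -ltr_pdivlMr; last by lra.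
    have [r_eq0|r_gt0] := leP r 0; last by rewrite cE//; exact: log_odds_div_lt.
    rewrite c2; last by lra.
    by rewrite ltr_pdivlMr ?log_odds_gt//; lra.
  + exact: continuous_subspaceT.
Qed.

(** Relative entropy is half the Bregman divergence of [sym_entropy] between [2 * q - 1] and
    [2 * p - 1]; the terms in [ln 2] cancel. *)
Lemma rel_entropyE p q : 0 < p < 1 -> 0 <= q <= 1 ->
  rel_entropy q p = (sym_entropy (2 * q - 1) - sym_entropy (2 * p - 1) -
                     2 * (q - p) * log_odds (2 * p - 1)) / 2.
Proof.
move=> /andP[p0 p1] /andP[q0 q1].
have xlnxV (x y : R) : 0 <= x -> 0 < y ->
    x * ln (x / y) = x * ln (2 * x) - x * ln (2 * y).
  rewrite le_eqVlt => /orP[/eqP<-|x0] y0; first by rewrite !mul0r subr0.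
  by rewrite ln_div ?posrE// !lnM ?posrE//; ring.
rewrite /rel_entropy !xlnxV; [|lra..].
rewrite /sym_entropy /log_odds.
have -> : 1 + (2 * q - 1) = 2 * q by ring.
have -> : 1 - (2 * q - 1) = 2 * (1 - q) by ring.
have -> : 1 + (2 * p - 1) = 2 * p by ring.
have -> : 1 - (2 * p - 1) = 2 * (1 - p) by ring.
by field.
Qed.

Lemma critical_betaE p : 0 < p < 1 ->
  critical_beta p * (2 * p - 1) = log_odds (2 * p - 1).
Proof.
move=> /andP[p0 p1]; rewrite /critical_beta /log_odds.
case: eqP => [->|/eqP pn].
  have -> : 2 * 2^-1 - 1 = 0 :> R by field.
  by rewrite mulr0 addr0 subr0 subrr.
have p2 : 2 * p - 1 != 0 by apply: contraNneq pn => h; apply/eqP; lra.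
rewrite divfK//.
have -> : 1 + (2 * p - 1) = 2 * p by ring.
have -> : 1 - (2 * p - 1) = 2 * (1 - p) by ring.
rewrite ln_div ?posrE ?subr_gt0// !lnM ?posrE ?subr_gt0//; ring.
Qed.

Lemma rel_entropy_refl p : 0 < p < 1 -> rel_entropy p p = 0.
Proof.
move=> p01; rewrite rel_entropyE//; last by lra.
by rewrite !subrr; ring.
Qed.

(** As [sym_entropy] is even, its values at the two mirror points cancel and only the linear term of
    the Bregman divergence remains. *)
Lemma rel_entropy_onem p : 0 < p < 1 ->
  rel_entropy (1 - p) p = critical_beta p * (1 - 2 * p) ^+ 2.
Proof.
move=> p01; rewrite rel_entropyE//; last by lra.
have -> : 2 * (1 - p) - 1 = - (2 * p - 1) by ring.
by rewrite sym_entropyN subrr -critical_betaE//; field.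
Qed.

(** The tangent bound is used at the absolute values of [2 * p - 1] and [2 * q - 1], which agree
    exactly for the two excluded [q]. *)
Lemma rel_entropy_gt p q : 0 < p < 1 -> 0 <= q <= 1 -> q != p -> q != 1 - p ->
  critical_beta p * (q - p) ^+ 2 < rel_entropy q p.
Proof.
move=> p01 q01 qp qp'.
have sym_norm (x : R) : sym_entropy `|x| = sym_entropy x.
  by have [x0|x0] := leP 0 x;
    rewrite ?(ger0_norm x0) ?(ltr0_norm x0) ?sym_entropyN.
have := @sym_entropy_gt_tangent `|2 * p - 1| `|2 * q - 1| (critical_beta p).
rewrite !sym_norm !real_normK ?num_real// => h.
have {h} : sym_entropy (2 * p - 1) +
    critical_beta p / 2 * ((2 * q - 1) ^+ 2 - (2 * p - 1) ^+ 2) <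
    sym_entropy (2 * q - 1).
  apply: h.
  - by rewrite normr_ge0/= ltr_norml; lra.
  - by rewrite normr_ge0/= ler_norml; lra.
  - rewrite eqr_norm2; apply/negP => /orP[] /eqP h.
      by move/eqP : qp; apply; lra.
    by move/eqP : qp'; apply; lra.
  - have [x0|x0] := leP 0 (2 * p - 1).
      by rewrite (ger0_norm x0) critical_betaE.
    by rewrite (ltr0_norm x0) log_oddsN mulrN critical_betaE.
  - move/eqP; rewrite normr_eq0 => /eqP h.
    rewrite /critical_beta ifT//; apply/eqP; lra.
(* The linear term completes the square: with [r = 2 * p - 1], [s = 2 * q - 1] and
   [c = critical_beta p], [c / 2 * (s ^+ 2 - r ^+ 2) - c * r * (s - r)] equals
   [c / 2 * (s - r) ^+ 2]. *)
rewrite rel_entropyE// -critical_betaE//.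
by lra.
Qed.

Lemma rel_entropy_ge p q : 0 < p < 1 -> 0 <= q <= 1 ->
  critical_beta p * (q - p) ^+ 2 <= rel_entropy q p.
Proof.
move=> p01 q01; have [->|qp] := eqVneq q p.
  by rewrite rel_entropy_refl// subrr expr0n/= mulr0.
have [->|qp'] := eqVneq q (1 - p).
  by rewrite rel_entropy_onem// (_ : 1 - p - p = 1 - 2 * p)//; ring.
exact/ltW/rel_entropy_gt.
Qed.

(** Applying [ln x <= x - 1] to both logarithms gives the chi-squared divergence. The bound makes
    the entropy integrand bounded and the cost of a small change of value quadratic. *)
Lemma rel_entropy_le p q : 0 < p < 1 -> 0 <= q <= 1 ->
  rel_entropy q p <= (q - p) ^+ 2 / (p * (1 - p)).
Proof.
move=> /andP[p0 p1] /andP[q0 q1].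
have bound (x y : R) : 0 <= x -> 0 < y -> x * ln (x / y) <= x * (x / y - 1).
  rewrite le_eqVlt => /orP[/eqP<-|x0] y0; first by rewrite !mul0r.
  rewrite ler_pM2l//; have := @le_ln1Dx R (x / y - 1).
  have -> : 1 + (x / y - 1) = x / y by ring.
  by apply; have := divr_gt0 x0 y0; lra.
have h1 := bound q p q0 p0; have h2 := bound (1 - q) (1 - p) ltac:(lra) ltac:(lra).
rewrite /rel_entropy (le_trans (lerD h1 h2))// le_eqVlt; apply/orP; left.
apply/eqP; have ? : p != 0 by rewrite gt_eqF.
have ? : 1 - p != 0 by rewrite gt_eqF// subr_gt0.
by field; apply/andP.
Qed.

Lemma critical_beta_gt0 p : 0 < p < 1 -> 0 < critical_beta p.
Proof.
move=> /andP[p0 p1]; rewrite /critical_beta; case: eqP => // /eqP pn.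
have q0 : 0 < 1 - p by lra.
rewrite ln_div ?posrE//.
have [plt|plt|pe] := ltgtP p 2^-1; last by rewrite pe eqxx in pn.
  rewrite -mulrNN -invrN mulr_gt0 ?invr_gt0//; last by lra.
  by rewrite opprB subr_gt0 ltr_ln ?posrE//; lra.
by rewrite mulr_gt0 ?invr_gt0// ?subr_gt0 ?ltr_ln ?posrE//; lra.
Qed.

(** Here the second contact point [1 - p] merges with [p], so [b] has to come from the local
    behaviour, where the entropy is [2 * b ^+ 2] to leading order. *)
Lemma rel_entropy_half_lt beta : 2 < beta ->
  exists b : R, 0 < 2^-1 + b < 1 /\
    rel_entropy (2^-1 + b) 2^-1 < beta * b ^+ 2.
Proof.
move=> b2; have b0 : 0 < beta by lra.
(* Chosen so that [2 / (1 - s) = beta]: for [0 < x < s], [x ^+ 2 < s] and hence [log_odds x < 2 * x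
   / (1 - x ^+ 2) < beta * x]. *)
pose s : R := 1 - 2 / beta.
have sb : s * beta = beta - 2 by rewrite /s mulrBl divfK ?gt_eqF// mul1r.
have s0 : 0 < s by rewrite /s subr_gt0 ltr_pdivrMr// mul1r.
have s1 : s < 1 by rewrite /s ltrBlDr ltrDl divr_gt0.
exists (s / 2); split; first by lra.
rewrite rel_entropyE; [|lra..].
have -> : 2 * (2^-1 + s / 2) - 1 = s by field.
have -> : 2 * 2^-1 - 1 = 0 :> R by field.
have -> : sym_entropy 0 = 0 by rewrite /sym_entropy addr0 subr0 ln1 mulr0 addr0.
have -> : log_odds 0 = 0 by rewrite /log_odds addr0 subr0 subrr.
pose h (x : R) := beta / 2 * x ^+ 2 - sym_entropy x.
pose dh (x : R) := beta * x - log_odds x.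
have hdh (x : R) : -1 < x < 1 -> is_derive x 1 h (dh x).
  move=> x1; have d1 := is_derive_sym_entropy x1.
  have d2 : is_derive x 1 (fun x : R => beta / 2 * x ^+ 2) (beta * x).
    by apply: is_derive_eq; rewrite /GRing.scale/= /GRing.scale/=; field.
  exact: is_deriveB d2 d1.
have : h 0 < h s.
  apply: (@is_derive_lt_cc h dh 0 s) => //.
  - by move=> x /andP[? ?]; apply: hdh; lra.
  - move=> x /andP[x0 xs]; rewrite /dh subr_gt0.
    apply: (lt_trans (log_odds_lt _)); first by lra.
    have xs2 : x ^+ 2 < s by nra.
    rewrite ltr_pdivrMr ?subr_gt0; last by lra.
    rewrite mulrAC ltr_pM2r//; have : beta * x ^+ 2 < beta * s by rewrite ltr_pM2l.
    by lra.
  - by apply: (@derivable_continuous_within h dh) => x /andP[? ?]; apply: hdh; lra.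
have -> : h 0 = 0.
  by rewrite /h /sym_entropy addr0 subr0 ln1 expr0n/= !mulr0 addr0 subr0.
by rewrite /h subr_gt0 => ?; lra.
Qed.

Lemma exists_perturbation p beta : 0 < p < 1 -> critical_beta p < beta ->
  exists b : R, 0 < p + b < 1 /\ rel_entropy (p + b) p < beta * b ^+ 2.
Proof.
move=> p01 cb; have [pE|pn] := eqVneq p 2^-1.
  by rewrite pE; apply: rel_entropy_half_lt; move: cb; rewrite /critical_beta pE eqxx.
have p2 : 1 - 2 * p != 0 by apply: contraNneq pn => h; apply/eqP; lra.
(* This moves [p] to [1 - p], where the quadratic lower bound is an equality. *)
exists (1 - 2 * p); split=> //; first by lra.
have -> : p + (1 - 2 * p) = 1 - p by ring.
by rewrite rel_entropy_onem// ltr_pM2r// exprn_even_gt0.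
Qed.

End RelativeEntropy.

(** * The free energy of graphons *)

Section Graphons.
Context {R : realType}.
Local Notation plane := (measurableTypeR R * measurableTypeR R)%type.
Local Notation mu := (@lebesgue_measure R).
Local Notation mu2 := (mu \x mu)%E.
Local Notation I01 := (`[0%R, 1%R]%classic : set (measurableTypeR R)).
Local Notation square := (@unit_square R).
Implicit Types (W f g : plane -> R) (p beta : R).

Lemma Rintegral_unit_squareD f g : bounded_measurable square f ->
  bounded_measurable square g ->
  \int[mu2]_(z in square) (f z + g z) =
  \int[mu2]_(z in square) f z + \int[mu2]_(z in square) g z.
Proof.
move=> bf bg; apply: RintegralD; first exact: measurable_unit_square.
  exact: integrable_unit_square.
exact: integrable_unit_square.
Qed.

Lemma Rintegral_unit_squareB f g : bounded_measurable square f ->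
  bounded_measurable square g ->
  \int[mu2]_(z in square) (f z - g z) =
  \int[mu2]_(z in square) f z - \int[mu2]_(z in square) g z.
Proof.
move=> bf bg; apply: RintegralB; first exact: measurable_unit_square.
  exact: integrable_unit_square.
exact: integrable_unit_square.
Qed.

Lemma Rintegral_unit_squareZ c f : bounded_measurable square f ->
  \int[mu2]_(z in square) (c * f z) = c * \int[mu2]_(z in square) f z.
Proof.
move=> bf; apply: RintegralZl; first exact: measurable_unit_square.
exact: integrable_unit_square.
Qed.

Lemma graphon_bounded_measurable W : graphon W -> bounded_measurable square W.
Proof.
by move=> [mW _ W01]; split=> //; exists 1 => z /W01/andP[? ?]; rewrite ger0_norm.
Qed.

Lemma bounded_measurable_rel_entropy W p : 0 < p < 1 -> graphon W ->
  bounded_measurable square (fun z => rel_entropy (W z) p).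
Proof.
move=> /andP[p0 p1] [mW _ W01].
have mlnV (f : plane -> R) (c : R) : measurable_fun square f ->
    measurable_fun square (fun z => f z * ln (f z / c)).
  move=> mf; apply: measurable_funM => //.
  by apply: measurableT_comp; [exact: measurable_ln|exact: measurable_funM].
split; first by apply: measurable_funD; apply: mlnV => //; exact: measurable_funB.
(* The bound is [rel_entropy_le] together with [(W z - p) ^+ 2 <= 1]. *)
exists (p * (1 - p))^-1 => z /W01 Wz.
have p01 : 0 < p < 1 by rewrite p0.
have D0 : 0 <= rel_entropy (W z) p.
  apply: le_trans (rel_entropy_ge p01 Wz).
  by rewrite mulr_ge0 ?sqr_ge0// ltW// critical_beta_gt0.
rewrite ger0_norm// (le_trans (rel_entropy_le p01 Wz))//.
rewrite ler_piMl//; first by rewrite invr_ge0; nra.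
by move: Wz => /andP[? ?]; nra.
Qed.

(** [f] is the degree function minus its mean [p], and [two_star W] is the second moment of the
    degree, so the last identity is the variance formula. *)
Lemma degree_deviation W p : graphon_density p W ->
  let f x := \int[mu]_(y in I01) W (x, y) - p in
  [/\ bounded_measurable I01 f,
      \int[mu]_(x in I01) f x = 0 &
      \int[mu]_(x in I01) f x ^+ 2 = two_star W - p ^+ 2].
Proof.
move=> [gW dW] f; have bW := graphon_bounded_measurable gW.
have mI := @measurable_unit_interval R.
pose d x := \int[mu]_(y in I01) W (x, y).
have bd : bounded_measurable I01 d := bounded_measurable_marginal bW.
have bc (c : R) : bounded_measurable I01 (fun=> c) by exact: bounded_measurable_cst.
have dE : \int[mu]_(x in I01) d x = p by rewrite -dW (Rintegral_unit_square bW).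
split; first exact: bounded_measurableB.
  rewrite RintegralB //; [|exact: integrable_unit_interval..].
  by rewrite dE Rintegral_unit_interval_cst subrr.
have bd2 := bounded_measurable_sqr bd.
have bdZ := bounded_measurableZ (2 * p) bd.
transitivity (\int[mu]_(x in I01) (d x ^+ 2 - 2 * p * d x + p ^+ 2)).
  by apply: eq_Rintegral => x _; rewrite /f /d; ring.
rewrite RintegralD //; last 2 first.
  by apply: integrable_unit_interval; exact: bounded_measurableB.
  exact: integrable_unit_interval.
rewrite RintegralB //; [|exact: integrable_unit_interval..].
rewrite RintegralZl //; last exact: integrable_unit_interval.
rewrite dE Rintegral_unit_interval_cst /two_star -/d.
by ring.
Qed.

(* The symmetric kernel [W - p] is at least as large in [L^2] as its projection
   [f x + f y] on the sums of one-variable functions, whose square has integral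
   [2 * \int f^2] because [f] has mean zero. *)
Lemma two_star_le W p : graphon_density p W ->
  2 * (two_star W - p ^+ 2) <= \int[mu2]_(z in square) (W z - p) ^+ 2.
Proof.
move=> dW; have [bf f0 f2] := degree_deviation dW.
move: bf f0 f2; set f := (fun x => _ - p) => bf f0 f2.
have [gW _] := dW; have bW := graphon_bounded_measurable gW.
have [_ symW _] := gW; have mI := @measurable_unit_interval R.
pose g z := W z - p.
have bg : bounded_measurable square g.
  by apply: bounded_measurableB => //; exact: bounded_measurable_cst.
have bf1 := bounded_measurable_fst bf.
have bf2 := bounded_measurable_snd bf.
have bg2 := bounded_measurable_sqr bg.
have bf12 := bounded_measurable_sqr bf1.
have bf22 := bounded_measurable_sqr bf2.
have bgf1 := bounded_measurableM bg bf1.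
have bgf2 := bounded_measurableM bg bf2.
have bff := bounded_measurableM bf1 bf2.
have E1 : \int[mu2]_(z in square) f z.1 ^+ 2 = two_star W - p ^+ 2.
  rewrite (Rintegral_unit_square bf12) -f2; apply: eq_Rintegral => x _ /=.
  exact: Rintegral_unit_interval_cst.
have E2 : \int[mu2]_(z in square) f z.2 ^+ 2 = two_star W - p ^+ 2.
  by rewrite -E1 -(Rintegral_unit_square_swap bf12).
have E3 : \int[mu2]_(z in square) (g z * f z.1) = two_star W - p ^+ 2.
  rewrite (Rintegral_unit_square bgf1) -f2; apply: eq_Rintegral => x /set_mem Ix /=.
  have bWx := bounded_measurable_section Ix bW.
  have bgx := bounded_measurable_section Ix bg.
  rewrite RintegralZr //; last exact: integrable_unit_interval.
  rewrite expr2; congr (_ * _); rewrite RintegralB //.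
  - by rewrite Rintegral_unit_interval_cst.
  - exact: integrable_unit_interval.
  - exact/integrable_unit_interval/bounded_measurable_cst.
(* Symmetry of [W] enters here: it equates the projections in the two coordinates. *)
have E4 : \int[mu2]_(z in square) (g z * f z.2) = two_star W - p ^+ 2.
  rewrite -E3 -(Rintegral_unit_square_swap bgf1).
  by apply: eq_Rintegral => -[x y] /set_mem ? /=; rewrite /g symW.
have E5 : \int[mu2]_(z in square) (f z.1 * f z.2) = 0.
  rewrite (Rintegral_unit_square bff).
  rewrite -[RHS](Rintegral_unit_interval_cst 0); apply: eq_Rintegral => x _ /=.
  rewrite RintegralZl //; last exact: integrable_unit_interval.
  by rewrite f0 mulr0.
(* With [V = two_star W - p ^+ 2], the expansion integrates to [\int g^2 + 2 * V + 2 * (0 - 2 * V)],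
   that is, [\int g^2 - 2 * V]. *)
have : 0 <= \int[mu2]_(z in square) (g z - (f z.1 + f z.2)) ^+ 2.
  by apply: Rintegral_ge0 => z _; exact: sqr_ge0.
have -> : \int[mu2]_(z in square) (g z - (f z.1 + f z.2)) ^+ 2 =
    \int[mu2]_(z in square) (g z ^+ 2 + (f z.1 ^+ 2 + f z.2 ^+ 2) +
      2 * (f z.1 * f z.2 - (g z * f z.1 + g z * f z.2))).
  by apply: eq_Rintegral => z _; ring.
have b1 := bounded_measurableD bf12 bf22.
have b2 := bounded_measurableD bgf1 bgf2.
have b3 := bounded_measurableB bff b2.
rewrite (Rintegral_unit_squareD (bounded_measurableD bg2 b1)
  (bounded_measurableZ 2 b3)).
rewrite (Rintegral_unit_squareD bg2 b1) (Rintegral_unit_squareD bf12 bf22).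
rewrite (Rintegral_unit_squareZ 2 b3) (Rintegral_unit_squareB bff b2).
rewrite (Rintegral_unit_squareD bgf1 bgf2) E1 E2 E3 E4 E5.
by rewrite /g; lra.
Qed.

Lemma two_star_ge W p : graphon_density p W -> p ^+ 2 <= two_star W.
Proof.
move=> /degree_deviation[_ _ f2]; rewrite -subr_ge0 -f2.
by apply: Rintegral_ge0 => x _; exact: sqr_ge0.
Qed.

Lemma graphon_density_cst p : 0 <= p <= 1 -> graphon_density p (fun=> p : R).
Proof. by move=> p01; split; [split|exact: Rintegral_unit_square_cst]. Qed.

Lemma free_energy_cst beta p : 0 < p < 1 ->
  free_energy beta p (fun=> p) = beta * p ^+ 2.
Proof.
move=> p01; rewrite /free_energy /two_star /rate rel_entropy_refl//.
rewrite (Rintegral_unit_square_cst 0) mulr0 subr0.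
rewrite (Rintegral_unit_interval_cst p); congr (_ * _).
exact: Rintegral_unit_interval_cst.
Qed.

Lemma entropy_gap_bounded_measurable W p : 0 < p < 1 -> graphon W ->
  bounded_measurable square
    (fun z => rel_entropy (W z) p - critical_beta p * (W z - p) ^+ 2).
Proof.
move=> p01 gW; apply: bounded_measurableB.
  exact: bounded_measurable_rel_entropy.
apply/bounded_measurableZ/bounded_measurable_sqr/bounded_measurableB.
  exact: graphon_bounded_measurable.
exact: bounded_measurable_cst.
Qed.

(** The variance [two_star W - p ^+ 2] is nonnegative, so [beta] may be raised to [critical_beta p]
    before [two_star_le] is applied. The entropy gap is kept on the left: its sign gives maximality,
    and its vanishing governs equality. *)
Lemma free_energy_le beta p W : 0 < p < 1 -> beta <= critical_beta p ->
  graphon_density p W ->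
  free_energy beta p W + 2^-1 * \int[mu2]_(z in square)
    (rel_entropy (W z) p - critical_beta p * (W z - p) ^+ 2) <= beta * p ^+ 2.
Proof.
move=> p01 bc dW; have [gW _] := dW.
have bg : bounded_measurable square (fun z => W z - p).
  apply: bounded_measurableB; last exact: bounded_measurable_cst.
  exact: graphon_bounded_measurable.
have bg2 := bounded_measurable_sqr bg.
rewrite (Rintegral_unit_squareB (bounded_measurable_rel_entropy p01 gW)
  (bounded_measurableZ _ bg2)) (Rintegral_unit_squareZ _ bg2).
have h1 := two_star_le dW; have h2 := two_star_ge dW.
have c0 := critical_beta_gt0 p01.
rewrite /free_energy /rate.
have h3 : beta * (two_star W - p ^+ 2) <= critical_beta p * (two_star W - p ^+ 2).
  by rewrite ler_wpM2r// subr_ge0.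
move: h1; rewrite -(ler_pM2l c0).
by lra.
Qed.

Lemma entropy_gap_eq0 p W : 0 < p < 1 -> graphon_density p W ->
  \int[mu2]_(z in square)
    (rel_entropy (W z) p - critical_beta p * (W z - p) ^+ 2) = 0 ->
  ae_eq mu2 square W (fun=> p).
Proof.
move=> p01 [gW dW] gap0; have mS := @measurable_unit_square R.
have bW := graphon_bounded_measurable gW; have [_ _ W01] := gW.
have bg : bounded_measurable square (fun z => W z - p).
  by apply: bounded_measurableB => //; exact: bounded_measurable_cst.
have bg2 := bounded_measurable_sqr bg.
have bga := bounded_measurableZ (1 - 2 * p) bg.
have gap_ae := Rintegral_eq0_ae_eq0 mS (integrable_unit_square
  (entropy_gap_bounded_measurable p01 gW)).
have {gap_ae} gap_ae : ae_eq mu2 square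
    (fun z => rel_entropy (W z) p - critical_beta p * (W z - p) ^+ 2) (fun=> 0).
  by apply: gap_ae => // z /W01 Wz; rewrite subr_ge0 rel_entropy_ge.
(* This equation encodes that [W z] is [p] or [1 - p]. Its right side is linear in [W z - p], hence
   has integral 0, which forces the square to integrate to 0. *)
have two_valued : ae_eq mu2 square (fun z => ((W z - p) ^+ 2)%:E)
    (fun z => ((1 - 2 * p) * (W z - p))%:E).
  apply: filterS gap_ae => z /= + Sz => /(_ Sz)/eqP; rewrite subr_eq0 => /eqP Dz.
  congr _%:E; have [->|Wp] := eqVneq (W z) p; first by rewrite subrr expr0n mulr0.
  have [->|Wp'] := eqVneq (W z) (1 - p); first by ring.
  by have := rel_entropy_gt p01 (W01 _ Sz) Wp Wp'; rewrite Dz ltxx.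
have g2_0 : \int[mu2]_(z in square) (W z - p) ^+ 2 = 0.
  transitivity (\int[mu2]_(z in square) ((1 - 2 * p) * (W z - p))).
    congr fine; apply: ae_eq_integral => //.
      by apply/measurable_EFinP; case: bg2.
    by apply/measurable_EFinP; case: bga.
  rewrite (Rintegral_unit_squareZ _ bg).
  rewrite (Rintegral_unit_squareB bW (bounded_measurable_cst _ _)).
  by rewrite dW Rintegral_unit_square_cst subrr mulr0.
have := Rintegral_eq0_ae_eq0 mS (integrable_unit_square bg2).
move=> /(_ (fun z _ => sqr_ge0 _) g2_0).
apply: filterS => z /= + Sz => /(_ Sz)/eqP.
by rewrite sqrf_eq0 subr_eq0 => /eqP.
Qed.

Lemma unique_maximizer_cst beta p : 0 < p < 1 -> beta <= critical_beta p ->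
  unique_maximizer beta p (fun=> p).
Proof.
move=> p01 bc.
have dp : graphon_density p (fun=> p) by apply: graphon_density_cst; lra.
have gap_ge0 W : graphon W -> 0 <= \int[mu2]_(z in square)
    (rel_entropy (W z) p - critical_beta p * (W z - p) ^+ 2).
  move=> [_ _ W01]; apply: Rintegral_ge0 => z /W01 Wz.
  by rewrite subr_ge0 rel_entropy_ge.
split.
  split=> // W dW; rewrite free_energy_cst//.
  have := free_energy_le p01 bc dW; have [gW _] := dW.
  by move: (gap_ge0 _ gW); clear; lra.
move=> W [dW maxW]; apply: entropy_gap_eq0 => //.
have := maxW _ dp; rewrite free_energy_cst//.
have := free_energy_le p01 bc dW; have [gW _] := dW.
by move: (gap_ge0 _ gW); clear; lra.
Qed.

(** * Graphons with two blocks *)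

Section Blocks.
Variable e : R.
Hypothesis e01 : 0 <= e <= 1.

Definition step (u v : R) (x : R) : R := if x <= e then u else v.

(** Nesting [step] reduces the degrees and all integrals over the square to [Rintegral_step]. *)
Definition block (u v w : R) (z : plane) : R :=
  step (step u v z.2) (step v w z.2) z.1.

Lemma bounded_measurable_step u v : bounded_measurable I01 (step u v).
Proof.
split; last first.
  exists (`|u| + `|v|) => x _; rewrite /step.
  by case: ifP => _; rewrite ?lerDl ?lerDr normr_ge0.
apply: measurable_funTS; apply: measurable_fun_ifT => //.
exact: measurable_fun_ler.
Qed.

Lemma bounded_measurable_block u v w : bounded_measurable square (block u v w).
Proof.
split; last first.
  exists (`|u| + `|v| + `|w|) => -[x y] _; rewrite /block /step.
  have := normr_ge0 u; have := normr_ge0 v; have := normr_ge0 w.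
  by case: ifP => _; case: ifP => _ ? ? ?; lra.
apply: measurable_funTS.
have m1 : measurable_fun setT (fun z : plane => z.1 <= e).
  by apply: measurable_fun_ler => //; exact: measurable_fst.
have m2 : measurable_fun setT (fun z : plane => z.2 <= e).
  by apply: measurable_fun_ler => //; exact: measurable_snd.
by apply: measurable_fun_ifT => //; apply: measurable_fun_ifT.
Qed.

Lemma Rintegral_step u v :
  \int[mu]_(x in I01) step u v x = e * u + (1 - e) * v.
Proof.
have mI := @measurable_unit_interval R.
have itvE : I01 `&` `]-oo, e]%classic = `[0, e]%classic.
  apply/seteqP; split=> x /=; rewrite !in_itv/=; move: e01; clear.
    by move=> ? [/andP[? ?] ?]; lra.
  by move=> ? /andP[? ?]; split; lra.
have me : \int[mu]_(x in I01) step 1 0 x = e.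
  transitivity (\int[mu]_(x in I01) ((cst 1 : R -> R) \_ `]-oo, e]%classic) x).
    apply: eq_Rintegral => x _; rewrite /step patchE.
    by rewrite mem_setE in_itv/=; case: ifP.
  rewrite -Rintegral_mkcondr itvE Rintegral_cst; last exact: measurable_itv.
  rewrite mul1r; transitivity (fine (mu `[0, e]%classic)) => //.
  rewrite lebesgue_measure_itv/= lte_fin.
  by case: ifPn => [_|]; [rewrite oppr0 adde0|rewrite -leNgt /=; move: e01; lra].
have b0 := bounded_measurable_step 1 0.
have bZ := bounded_measurableZ (u - v) b0.
have bc (c : R) : bounded_measurable I01 (fun=> c) by exact: bounded_measurable_cst.
transitivity (\int[mu]_(x in I01) (v + (u - v) * step 1 0 x)).
  by apply: eq_Rintegral => x _; rewrite /step; case: ifP => _; ring.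
rewrite RintegralD //; [|exact: integrable_unit_interval..].
rewrite RintegralZl //; last exact: integrable_unit_interval.
by rewrite me Rintegral_unit_interval_cst; ring.
Qed.

Lemma degree_block u v w x : \int[mu]_(y in I01) block u v w (x, y) =
  step (e * u + (1 - e) * v) (e * v + (1 - e) * w) x.
Proof.
by rewrite /block /= [in RHS]/step; case: ifPn => xe;
  rewrite -Rintegral_step; apply: eq_Rintegral => y _; rewrite /= /step ?xe ?(negbTE xe).
Qed.

Lemma Rintegral_block u v w : \int[mu2]_(z in square) block u v w z =
  e * (e * u + (1 - e) * v) + (1 - e) * (e * v + (1 - e) * w).
Proof.
rewrite (Rintegral_unit_square (bounded_measurable_block u v w)).
by rewrite -Rintegral_step; apply: eq_Rintegral => x _; exact: degree_block.
Qed.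

Lemma two_star_block u v w : two_star (block u v w) =
  e * (e * u + (1 - e) * v) ^+ 2 + (1 - e) * (e * v + (1 - e) * w) ^+ 2.
Proof.
rewrite -Rintegral_step; apply: eq_Rintegral => x _.
by rewrite [X in X ^+ 2]degree_block /step; case: ifP.
Qed.

Lemma rate_block p u v w : rate p (block u v w) =
  2^-1 * (e * (e * rel_entropy u p + (1 - e) * rel_entropy v p) +
          (1 - e) * (e * rel_entropy v p + (1 - e) * rel_entropy w p)).
Proof.
rewrite /rate -Rintegral_block; congr (_ * _); apply: eq_Rintegral => z _.
by rewrite /block /step; case: ifP => _; case: ifP.
Qed.

Lemma graphon_block u v w : 0 <= u <= 1 -> 0 <= v <= 1 -> 0 <= w <= 1 ->
  graphon (block u v w).
Proof.
move=> u01 v01 w01; split; first by case: (bounded_measurable_block u v w).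
  by move=> x y _; rewrite /block /step /=; case: ifP => _; case: ifP.
by move=> z _; rewrite /block /step; case: ifP => _; case: ifP.
Qed.

End Blocks.

(* Raise [W] by [b] on the cross [A * A^c] over a set [A] of small measure [e];
   compensating the density on [A^c * A^c] costs only [O(e^2)], so the gain in
   free energy is [e * (beta * b^2 - rel_entropy (p + b) p)] to first order. *)
Lemma not_maximizer_cst beta p b : 0 < p < 1 -> 0 < p + b < 1 ->
  rel_entropy (p + b) p < beta * b ^+ 2 -> ~ maximizer beta p (fun=> p).
Proof.
move=> p01 pb01 Db [_ maxp].
have [p0 p1] := andP p01; have [pb0 pb1] := andP pb01.
pose q := p * (1 - p).
pose delta := beta * b ^+ 2 - rel_entropy (p + b) p.
(* The denominator gives both [k < 4^-1] and [4 * k < delta]. The factor [q] in [e] cancels the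
   denominator of [rel_entropy_le] and yields [4 * e < q], which keeps [p - eta] in the unit
   interval. *)
pose k := delta / (4 * delta + 8).
pose e := q * k.
have delta_gt0 : 0 < delta by rewrite subr_gt0.
have q_gt0 : 0 < q by rewrite /q; nra.
have q_le : q <= 4^-1 by rewrite /q; have := sqr_ge0 (p - 2^-1); lra.
have d8 : 0 < 4 * delta + 8 by lra.
have k_gt0 : 0 < k by rewrite /k divr_gt0.
have k_lt : k < 4^-1 by rewrite /k ltr_pdivrMr//; lra.
have k_delta : 4 * k < delta.
  by rewrite /k mulrA ltr_pdivrMr//; nra.
have e_gt0 : 0 < e by rewrite /e mulr_gt0.
have e_lt : e < 2^-1 by rewrite /e; nra.
have b_abs : b ^+ 2 < 1 by nra.
have e1 : 1 - e != 0 by rewrite gt_eqF; lra.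
(* Density balance: the cross has measure [2 * e * (1 - e)] and the compensating block has measure
   [(1 - e) ^+ 2]. *)
have [eta etaE] : exists eta, (1 - e) * eta = 2 * e * b.
  by exists (2 * e * b / (1 - e)); rewrite mulrC divfK.
have eta2 : eta ^+ 2 <= (4 * e) ^+ 2.
  have : ((1 - e) * eta) ^+ 2 <= (2 * e) ^+ 2.
    by rewrite etaE exprMn ler_piMr ?sqr_ge0// ltW.
  have : 4^-1 * eta ^+ 2 <= ((1 - e) * eta) ^+ 2.
    by rewrite exprMn ler_wpM2r ?sqr_ge0//; nra.
  by lra.
have eta_le : `|eta| <= 4 * e.
  by rewrite -(ler_pXn2r (_ : 0 < 2)%N)// ?nnegrE ?real_normK ?num_real//; lra.
have eta_q : `|eta| <= q.
  by apply: le_trans eta_le _; rewrite /e; nra.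
have w01 : 0 <= p - eta <= 1.
  by move: eta_q; rewrite ler_norml /q => /andP[? ?]; nra.
have e01 : 0 <= e <= 1 by lra.
have dW : graphon_density p (block e p (p + b) (p - eta)).
  split; first by apply: graphon_block => //; lra.
  rewrite Rintegral_block//.
  have -> : (1 - e) * (e * (p + b) + (1 - e) * (p - eta)) =
    (1 - e) * (p + e * b - (1 - e) * eta) by ring.
  by rewrite etaE; ring.
have := maxp _ dW; rewrite free_energy_cst// /free_energy two_star_block//.
rewrite rate_block// rel_entropy_refl//.
have -> : e * (p + b) + (1 - e) * (p - eta) = p + e * b - (1 - e) * eta by ring.
rewrite etaE; apply/negP; rewrite -ltNge.
(* In [(1 - e) * eta ^+ 2 / q], one factor [eta] is traded for [2 * e * b] by [etaE], and then
   [b * eta <= 4 * e = 4 * q * k]. *)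
have Dw : (1 - e) * rel_entropy (p - eta) p <= 2 * e * (4 * k).
  have := rel_entropy_le p01 w01.
  rewrite (_ : p - eta - p = - eta); last by ring.
  rewrite sqrrN -/q => h.
  apply: (@le_trans _ _ ((1 - e) * (eta ^+ 2 / q))).
    by rewrite ler_wpM2l//; lra.
  rewrite mulrA ler_pdivrMr// expr2 mulrA etaE.
  have be : b * eta <= 4 * e.
    have : `|b * eta| <= 4 * e.
      rewrite normrM (le_trans _ eta_le)// ler_piMl//.
      by rewrite ler_norml; lra.
    by rewrite ler_norml => /andP[].
  rewrite -(mulrA (2 * e)) -(mulrA (2 * e)) ler_wpM2l//; first by lra.
  by move: be; rewrite /e; lra.
rewrite -subr_gt0.
(* The degrees are [p + (1 - e) * b] and [p - e * b], with mean [p] and variance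
   [e * (1 - e) * b ^+ 2]. The gain is therefore exactly [e * (1 - e) * delta] minus the entropy
   cost of the compensation. *)
have -> : beta * (e * (e * p + (1 - e) * (p + b)) ^+ 2 +
      (1 - e) * (p + e * b - 2 * e * b) ^+ 2) -
    2^-1 * (e * (e * 0 + (1 - e) * rel_entropy (p + b) p) +
      (1 - e) * (e * rel_entropy (p + b) p +
        (1 - e) * rel_entropy (p - eta) p)) - beta * p ^+ 2 =
    (1 - e) * (e * delta - 2^-1 * ((1 - e) * rel_entropy (p - eta) p)).
  by rewrite /delta; field.
apply: mulr_gt0; first by lra.
have : e * (4 * k) < e * delta by rewrite ltr_pM2l.
by lra.
Qed.

End Graphons.

Theorem proposition1p1 (R : realType) (p beta : R)
    (p_gt0 : 0 < p) (p_lt1 : p < 1) (beta_ge0 : 0 <= beta) :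
  (beta <= critical_beta p -> unique_maximizer beta p (fun=> p)) /\
  (critical_beta p < beta -> ~ maximizer beta p (fun=> p)).
Proof.
have p01 : 0 < p < 1 by rewrite p_gt0.
split=> [|cb]; first exact: unique_maximizer_cst.
have [b [pb01 Db]] := exists_perturbation p01 cb.
exact: not_maximizer_cst Db.
Qed.
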